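(* For every integer $n\ge 0$, there is a bijection between the set of isomorphism classes of $XY$-graphs on $n$ vertices with no isolates in $Y$ and the set of isomorphism classes of bipartite posets on $n$ elements which maps unbalanced $XY$-graphs to unbalanced bipartite posets and balanced $XY$-graphs to balanced bipartite posets.
   Context: An $XY$-graph is a bipartite graph with a specified ordered bipartition $X\cup Y$ of its vertices (edges join $X$ to $Y$); isomorphisms must map $X$ onto $X'$ and $Y$ onto $Y'$. A vertex of $Y$ is an isolate if it has no neighbor; a vertex of $X$ is universal if it is adjacent to every vertex of $Y$. An $XY$-graph with no isolates in $Y$ is unbalanced if $X$ has a universal vertex and balanced otherwise. A bipartite poset is a finite poset of height at most one (no $x\prec y\prec z$). An element $v$ has height 1 if some $u\prec v$, height 0 otherwise; a height-0 element is a full support point if it is comparable to every height-1 element. A bipartite poset is unbalanced if it has a full support point and balanced otherwise. Posets are considered up to isomorphism. *)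

(* Defs.v *)
From HB Require Import structures.
From mathcomp Require Import all_boot all_order.

Set Implicit Arguments.
Unset Strict Implicit.
Unset Printing Implicit Defensive.

(* [Y] is the complement of [xpart]; [xy_bip] says that every edge has exactly
   one end in each part, which also excludes loops. *)
Record xygraph := XYGraph {
  xy_vertex : finType;
  xpart : {set xy_vertex};
  adj : rel xy_vertex;
  xy_sym : symmetric adj;
  xy_bip : forall u v, adj u v -> (u \in xpart) != (v \in xpart)
}.

Definition ypart (G : xygraph) : {set xy_vertex G} := ~: xpart G.

Definition xy_order (G : xygraph) : nat := #|xy_vertex G|.

Definition xy_iso (G H : xygraph) : Prop :=
  exists f : xy_vertex G -> xy_vertex H,
    [/\ bijective f,
        {mono f : u v / adj u v},
        f @: xpart G = xpart H &
        f @: ypart G = ypart H].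

Definition isolate (G : xygraph) (y : xy_vertex G) : bool :=
  [forall v, ~~ adj y v].

Definition no_isolates (G : xygraph) : bool :=
  [forall y in ypart G, ~~ isolate y].

Definition universal (G : xygraph) (x : xy_vertex G) : bool :=
  [forall y in ypart G, adj x y].

Definition xy_unbalanced (G : xygraph) : bool :=
  no_isolates G && [exists x in xpart G, universal x].

Definition xy_balanced (G : xygraph) : bool :=
  no_isolates G && ~~ [exists x in xpart G, universal x].

Record bposet := BPoset {
  bp_disp : Order.disp_t;
  bp_elt : finPOrderType bp_disp;
  bp_bip : forall x y z : bp_elt, ~ ((x < y)%O /\ (y < z)%O)
}.

Definition bp_order (P : bposet) : nat := #|bp_elt P|.

Definition bp_iso (P Q : bposet) : Prop :=
  exists f : bp_elt P -> bp_elt Q,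
    bijective f /\ {mono f : x y / (x <= y)%O}.

Definition height1 (P : bposet) (v : bp_elt P) : bool :=
  [exists u : bp_elt P, (u < v)%O].

Definition height0 (P : bposet) (v : bp_elt P) : bool := ~~ height1 v.

Definition full_support_point (P : bposet) (u : bp_elt P) : bool :=
  height0 u && [forall v : bp_elt P, height1 v ==> (u >=< v)%O].

Definition bp_unbalanced (P : bposet) : bool :=
  [exists u : bp_elt P, full_support_point u].

Definition bp_balanced (P : bposet) : bool := ~~ bp_unbalanced P.

(* An isomorphism class is the predicate of being isomorphic to a given object.
   The classes range over all finite carriers, so they are plain predicates:
   [classical_sets.set] is confined to a universe below that of [finType]. *)
Definition xy_class (n : nat) : Type :=
  {C : xygraph -> Prop |
    exists G, [/\ xy_order G = n, no_isolates G & C = xy_iso G]}.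

Definition bp_class (n : nat) : Type :=
  {D : bposet -> Prop | exists P, bp_order P = n /\ D = bp_iso P}.

(* Main.v *)
Require Import Defs.
From HB Require Import structures.
From mathcomp Require Import all_boot all_order boolp.
From Corelib Require Import RelationClasses.

(** Directing every edge from [X] to [Y] turns an [XY]-graph into a poset of
    height at most one. When [Y] has no isolates, the elements of height 1 are
    exactly [Y], so the graph is recovered from the comparability relation and
    universal vertices are the full support points. Since an isomorphism class
    is a predicate, both maps on classes are defined as images, without
    choosing representatives. *)

Set Implicit Arguments.
Unset Strict Implicit.
Unset Printing Implicit Defensive.

Import Order.TTheory.

Lemma bij_imset_eq (aT rT : finType) (f : aT -> rT) (A : {set aT})
    (B : {set rT}) : bijective f ->
  f @: A = B <-> {mono f : x / x \in A >-> x \in B}.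
Proof.
move=> [g fK gK]; have f_inj := can_inj fK.
split=> [<- x | fAB]; first exact: mem_imset.
by apply/setP => y; rewrite -[y]gK fAB mem_imset.
Qed.

Definition class_image (T U : Type) (S : U -> U -> Prop) (F : T -> U)
    (C : T -> Prop) : U -> Prop :=
  fun u => exists2 t, C t & S (F t) u.

Section EquivalenceClasses.
Context {T : Type} {R : T -> T -> Prop} {equivR : Equivalence R}.

Lemma eq_class (x y : T) : R x y -> R x = R y.
Proof.
move=> xy; apply/predeqP => z; split=> [xz | yz]; last by transitivity y.
by transitivity x; first symmetry.
Qed.

Context {U : Type} {S : U -> U -> Prop} {equivS : Equivalence S}.

Lemma class_image_class (F : T -> U) :
  {homo F : x y / R x y >-> S x y} ->
  forall x : T, class_image S F (R x) = S (F x).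
Proof.
move=> homoF x; apply/predeqP => u; split=> [[y /homoF xy yu] | xu].
  by transitivity (F y).
by exists x; first reflexivity.
Qed.

End EquivalenceClasses.

Lemma xy_isoP (G H : xygraph) : xy_iso G H <->
  exists f : xy_vertex G -> xy_vertex H,
    [/\ bijective f, {mono f : u v / adj u v} &
        {mono f : u / u \in xpart G >-> u \in xpart H}].
Proof.
split=> -[f] => [[bij_f adjf fX _] | [bij_f adjf fX]]; exists f; split=> //.
- exact/(bij_imset_eq _ _ bij_f).
- exact/(bij_imset_eq _ _ bij_f).
- by apply/(bij_imset_eq _ _ bij_f) => u; rewrite !in_setC fX.
Qed.

#[local] Instance xy_iso_equivalence : Equivalence xy_iso.
Proof.
split=> [G | G H /xy_isoP [f [[g fK gK] adjf fX]] |
         G H K /xy_isoP [f [bij_f adjf fX]] /xy_isoP [g [bij_g adjg gX]]];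
  apply/xy_isoP.
- by exists id; split=> //; exists id.
- exists g; split=> [| u v | u]; first by exists f.
    by rewrite -adjf !gK.
  by rewrite -fX gK.
- exists (g \o f); split=> [| u v | u] /=; first exact: bij_comp.
    by rewrite adjg adjf.
  by rewrite gX fX.
Qed.

Lemma adj_xpart (G : xygraph) (u v : xy_vertex G) :
  adj u v -> (v \in xpart G) = (u \notin xpart G).
Proof. by move/xy_bip; do 2!case: (_ \in _). Qed.

Lemma bp_isoP (P Q : bposet) : bp_iso P Q <->
  exists f : bp_elt P -> bp_elt Q,
    bijective f /\ {mono f : x y / (x < y)%O}.
Proof.
split=> -[f [bij_f monof]]; exists f; split=> //; first exact: leW_mono.
by move=> x y; rewrite !le_eqVlt monof (bij_eq bij_f).
Qed.

#[local] Instance bp_iso_equivalence : Equivalence bp_iso.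
Proof.
split=> [P | P Q [f [[g fK gK] lef]] | P Q S [f [bij_f lef]] [g [bij_g leg]]].
- by exists id; split=> //; exists id.
- by exists g; split=> [| x y]; [exists f | rewrite -lef !gK].
- exists (g \o f); split=> [| x y] /=; first exact: bij_comp.
  by rewrite leg lef.
Qed.

Lemma lt_height (P : bposet) (u v : bp_elt P) :
  (u < v)%O -> height0 u /\ height1 v.
Proof.
move=> uv; split; last by apply/existsP; exists u.
by apply/existsPn => w; apply/negP => wu; apply: (@bp_bip P w u v).
Qed.

Lemma mono_height1 (P Q : bposet) (f : bp_elt P -> bp_elt Q) :
  bijective f -> {mono f : x y / (x < y)%O} -> {mono f : x / height1 x}.
Proof.
move=> [g fK gK] ltf x.
apply/existsP/existsP => [] [y yx]; last by exists (f y); rewrite ltf.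
by exists (g y); rewrite -ltf gK.
Qed.

Lemma mono_full_support_point (P Q : bposet) (f : bp_elt P -> bp_elt Q) :
  bijective f -> {mono f : x y / (x <= y)%O} ->
  {mono f : x / full_support_point x}.
Proof.
move=> bij_f lef u; have f_height1 := mono_height1 bij_f (leW_mono lef).
rewrite /full_support_point /height0 f_height1; congr (_ && _).
have [g _ gK] := bij_f; apply/forallP/forallP => suppu v.
  by move: (suppu (f v)); rewrite f_height1 /Order.comparable !lef.
by rewrite -[v]gK f_height1 /Order.comparable !lef; apply: suppu.
Qed.

Lemma bp_iso_unbalanced (P Q : bposet) :
  bp_iso P Q -> bp_unbalanced P = bp_unbalanced Q.
Proof.
move=> [f [bij_f lef]]; have f_fullsupp := mono_full_support_point bij_f lef.
have [g _ gK] := bij_f; apply/existsP/existsP => [] [u suppu].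
  by exists (f u); rewrite f_fullsupp.
by exists (g u); rewrite -f_fullsupp gK.
Qed.

Section PosetOfGraph.
Variable G : xygraph.

Definition xy_poset_elt : Type := xy_vertex G.

HB.instance Definition _ := Finite.on xy_poset_elt.

Definition xy_lt : rel xy_poset_elt :=
  fun u v => (u \in xpart G) && adj u v.

Lemma xy_lt_nochain (u v w : xy_poset_elt) : xy_lt u v -> ~~ xy_lt v w.
Proof. by move=> /andP [uX /adj_xpart vX]; rewrite /xy_lt vX uX. Qed.

Fact xy_lt_irr : irreflexive xy_lt.
Proof.
by move=> u; apply/negP => uu; have := xy_lt_nochain u uu; rewrite uu.
Qed.

Fact xy_lt_trans : transitive xy_lt.
Proof. by move=> v u w uv vw; have := xy_lt_nochain w uv; rewrite vw. Qed.

HB.instance Definition _ :=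
  Order.Lt_isPOrder.Build (Order.Disp tt tt) xy_poset_elt
    xy_lt_irr xy_lt_trans.

Lemma xy_ltE (u v : xy_poset_elt) : (u < v)%O = (u \in xpart G) && adj u v.
Proof. by []. Qed.

Fact xy_poset_bip (x y z : xy_poset_elt) : ~ ((x < y)%O /\ (y < z)%O).
Proof. by move=> [/(xy_lt_nochain z) /negP]. Qed.

Definition xy_poset : bposet := BPoset xy_poset_bip.

(* The two finite structures on the carrier are not convertible, hence the
   detour through a bijection. *)
Lemma bp_order_xy_poset : bp_order xy_poset = xy_order G.
Proof.
by apply: (@bij_eq_card (bp_elt xy_poset) (xy_vertex G) id); exists id.
Qed.

Lemma xy_lt_or_gt (u v : xy_poset_elt) : (u < v)%O || (v < u)%O = adj u v.
Proof.
rewrite !xy_ltE [adj v u]xy_sym -andb_orl.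
by case: (boolP (adj u v)) => [/adj_xpart -> |]; rewrite ?andbF ?orbN.
Qed.

Hypothesis noG : no_isolates G.

Lemma height1_xy_poset (v : xy_vertex G) :
  height1 (P := xy_poset) v = (v \in ypart G).
Proof.
rewrite in_setC; apply/existsP/idP => [[u /andP [uX /adj_xpart ->]] | vY].
  by rewrite uX.
have /forallPn [u] : ~~ isolate v.
  by move/forall_inP: noG; apply; rewrite in_setC.
rewrite negbK xy_sym => uv; exists u.
by rewrite xy_ltE uv andbT -[_ \in _]negbK -(adj_xpart uv).
Qed.

Lemma full_support_point_xy_poset (u : xy_vertex G) :
  full_support_point (P := xy_poset) u = (u \in xpart G) && universal u.
Proof.
rewrite /full_support_point /height0 height1_xy_poset in_setC negbK.
apply: andb_id2l => uX.
have comparable_adj v : v \in ypart G -> ((u : xy_poset_elt) >=< v)%O = adj u v.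
  rewrite in_setC => vX; have uv : u != v by apply: contraNneq vX => <-.
  rewrite /Order.comparable !le_eqVlt [v == u]eq_sym (negPf uv).
  exact: xy_lt_or_gt.
apply/forallP/forall_inP => uP v; last first.
  by rewrite height1_xy_poset; apply/implyP => vY; rewrite comparable_adj ?uP.
move=> vY; rewrite -comparable_adj //.
by apply: (implyP (uP v)); rewrite height1_xy_poset.
Qed.

Lemma bp_unbalanced_xy_poset :
  bp_unbalanced xy_poset = [exists x in xpart G, universal x].
Proof.
apply/existsP/exists_inP => [[u] | [u uX univ_u]].
  by rewrite full_support_point_xy_poset => /andP [uX univ_u]; exists u.
by exists u; rewrite full_support_point_xy_poset uX.
Qed.

End PosetOfGraph.

Lemma xy_poset_homo : {homo xy_poset : G H / xy_iso G H >-> bp_iso G H}.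
Proof.
move=> G H /xy_isoP [f [bij_f adjf fX]]; apply/bp_isoP; exists f.
by split=> // u v; rewrite !xy_ltE fX adjf.
Qed.

Section GraphOfPoset.
Variable P : bposet.

Definition comparability : rel (bp_elt P) := fun u v => (u < v)%O || (v < u)%O.

Fact comparability_sym : symmetric comparability.
Proof. by move=> u v; rewrite /comparability orbC. Qed.

Fact comparability_bip (u v : bp_elt P) : comparability u v ->
  (u \in [set x | height0 x]) != (v \in [set x | height0 x]).
Proof. by rewrite !inE => /orP [] /lt_height [-> h]; rewrite /height0 h. Qed.

Definition comparability_graph : xygraph :=
  XYGraph comparability_sym comparability_bip.

Lemma comparability_graph_no_isolates : no_isolates comparability_graph.
Proof.
apply/forall_inP => v; rewrite !inE negbK => /existsP [u uv].
by apply/forallPn; exists u; rewrite negbK /= /comparability uv orbT.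
Qed.

Lemma comparability_graphK : bp_iso (xy_poset comparability_graph) P.
Proof.
apply/bp_isoP; exists id; split=> [|u v]; first by exists id.
rewrite xy_ltE inE /= /comparability.
apply/idP/andP => [uv | [u0 /orP [//| /lt_height [_ u1]]]].
  by have [u0 _] := lt_height uv; rewrite uv.
by rewrite /height0 u1 in u0.
Qed.

End GraphOfPoset.

Lemma comparability_graph_homo :
  {homo comparability_graph : P Q / bp_iso P Q >-> xy_iso P Q}.
Proof.
move=> P Q /bp_isoP [f [bij_f ltf]]; apply/xy_isoP; exists f.
split=> // [u v | u]; first by rewrite /= /comparability !ltf.
by rewrite !inE /height0 (mono_height1 bij_f ltf).
Qed.

Lemma xy_posetK (G : xygraph) :
  no_isolates G -> xy_iso (comparability_graph (xy_poset G)) G.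
Proof.
move=> noG; apply/xy_isoP; exists id; split=> [| u v | v]; first by exists id.
  by rewrite /= /comparability xy_lt_or_gt.
by rewrite inE /height0 height1_xy_poset // in_setC negbK.
Qed.

Section Classes.
Variable n : nat.

Fact class_image_xy_poset (C : xy_class n) :
  exists P, bp_order P = n /\ class_image bp_iso xy_poset (sval C) = bp_iso P.
Proof.
have [G [Gn _ ->]] := svalP C; exists (xy_poset G).
by rewrite bp_order_xy_poset (class_image_class xy_poset_homo).
Qed.

Definition poset_class (C : xy_class n) : bp_class n :=
  exist _ _ (class_image_xy_poset C).

Fact class_image_comparability_graph (D : bp_class n) : exists G,
  [/\ xy_order G = n, no_isolates G &
      class_image xy_iso comparability_graph (sval D) = xy_iso G].
Proof.
have [P [Pn ->]] := svalP D; exists (comparability_graph P).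
split=> //; first exact: comparability_graph_no_isolates.
exact: (class_image_class comparability_graph_homo).
Qed.

Definition graph_class (D : bp_class n) : xy_class n :=
  exist _ _ (class_image_comparability_graph D).

Lemma poset_classK : cancel poset_class graph_class.
Proof.
move=> C; apply: eq_sig_hprop => [D p q | /=]; first exact: Prop_irrelevance.
have [G [_ noG ->]] := svalP C.
rewrite (class_image_class xy_poset_homo).
rewrite (class_image_class comparability_graph_homo).
exact/eq_class/xy_posetK.
Qed.

Lemma graph_classK : cancel graph_class poset_class.
Proof.
move=> D; apply: eq_sig_hprop => [C p q | /=]; first exact: Prop_irrelevance.
have [P [_ ->]] := svalP D.
rewrite (class_image_class comparability_graph_homo).
rewrite (class_image_class xy_poset_homo).
exact/eq_class/comparability_graphK.
Qed.

Lemma poset_class_iso (C : xy_class n) (G : xygraph) (P : bposet) :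
  sval C G -> sval (poset_class C) P -> bp_iso (xy_poset G) P.
Proof.
have [H [_ _ CH]] := svalP C; rewrite /= CH => HG.
by rewrite (eq_class HG) (class_image_class xy_poset_homo).
Qed.

End Classes.

Theorem theorem5p3 (n : nat) :
  exists f : xy_class n -> bp_class n,
    bijective f /\
    forall (C : xy_class n) (G : xygraph) (P : bposet),
      sval C G -> sval (f C) P ->
      (xy_unbalanced G -> bp_unbalanced P) /\
      (xy_balanced G -> bp_balanced P).
Proof.
exists (@poset_class n); split.
  by exists (@graph_class n); [apply: poset_classK | apply: graph_classK].
move=> C G P CG CP; rewrite /bp_balanced.
rewrite -(bp_iso_unbalanced (poset_class_iso CG CP)).
by split=> /andP [noG]; rewrite bp_unbalanced_xy_poset.
Qed.
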